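(* Let $I$ be a nonempty set (finite, countably infinite or uncountable), let $1<p<\infty$, and let $D=[d_{ij}]_{i,j\in I}$ be a doubly stochastic operator. Then $\|D\|_{\ell^p(I)\to\ell^p(I)}=1$ if and only if $\Theta(D^*D)=1$.
   Context: A doubly stochastic operator indexed by $I$ is a matrix $D=[d_{ij}]_{i,j\in I}$ with real entries $d_{ij}\ge 0$ such that $\sum_{k\in I} d_{ik}=1$ and $\sum_{k\in I} d_{kj}=1$ for all $i,j\in I$. It acts on sequences by $(D\boldsymbol{x})_i=\sum_{j\in I} d_{ij}x_j$; it is known that this defines a bounded linear operator $\ell^p(I)\to\ell^p(I)$ of norm at most $1$ for every $1\le p\le\infty$. $\|D\|_{\ell^p(I)\to\ell^p(I)}=\sup_{\boldsymbol{x}\neq 0}\|D\boldsymbol{x}\|_p/\|\boldsymbol{x}\|_p$ denotes the operator norm. $D^*$ is the adjoint of $D$ on $\ell^2(I)$ (the transpose matrix), so $D^*D$ has entries $(D^*D)_{ij}=\sum_{k\in I} d_{ki}d_{kj}$, and it is again doubly stochastic. For a doubly stochastic operator $B=[b_{ij}]_{i,j\in I}$, define $$\Theta(B):=\sup_{S}\frac{1}{|S|}\sum_{i,j\in S} b_{ij},$$ where $S$ runs over the nonempty finite subsets of $I$ and $|S|$ is the cardinality of $S$. *)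

(* Defs.v *)
From HB Require Import structures.
From mathcomp Require Import all_boot all_order all_algebra finmap.
From mathcomp Require Import all_classical all_reals ereal esum exp.

Set Implicit Arguments.
Unset Strict Implicit.
Unset Printing Implicit Defensive.

Import Order.TTheory GRing.Theory Num.Theory.
Local Open Scope classical_set_scope.
Local Open Scope ring_scope.

Section Defs.
Context {R : realType} {I : choiceType}.
Implicit Types (x : I -> R) (A B D : I -> I -> R).

(* Unordered sum over I of an absolutely summable real family, as the sum of its
   positive part minus the sum of its negative part ([esum] is only meaningful
   for nonnegative terms). *)
Definition rsum x : R :=
  fine (\esum_(i in [set: I]) (Num.max (x i) 0)%:E) -
  fine (\esum_(i in [set: I]) (Num.max (- x i) 0)%:E).

Definition doubly_stochastic D : Prop :=
  [/\ forall i j, 0 <= D i j,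
      forall i, (\esum_(k in [set: I]) (D i k)%:E = 1)%E
    & forall j, (\esum_(k in [set: I]) (D k j)%:E = 1)%E].

Definition opact D x : I -> R := fun i => rsum (fun j => D i j * x j).

Definition lp_norm (p : R) x : \bar R :=
  ((\esum_(i in [set: I]) (`|x i| `^ p)%:E) `^ p^-1)%E.

Definition lp_space (p : R) : set (I -> R) :=
  [set x | (\esum_(i in [set: I]) (`|x i| `^ p)%:E < +oo)%E].

(* The supremum is taken in the extended reals, so an operator that is unbounded
   (or does not preserve l^p) has norm +oo. *)
Definition lp_opnorm (p : R) (T : (I -> R) -> (I -> R)) : \bar R :=
  ereal_sup [set (lp_norm p (T x) / lp_norm p x)%E
            | x in [set x | lp_space p x /\ x <> (fun=> 0)]].

(* Matrix of the adjoint on l^2(I) (real scalars). *)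
Definition adjoint D : I -> I -> R := fun i j => D j i.

Definition opmul A B : I -> I -> R := fun i j => rsum (fun k => A i k * B k j).

Definition Theta B : \bar R :=
  ereal_sup [set ((#|` S|%:R)^-1 * \sum_(i <- S) \sum_(j <- S) B i j)%:E
            | S in [set S : {fset I} | S != fset0]].

End Defs.

(* Main.v *)
(* Theta(D^*D) <= th says that the form sum_(j,k in S) (D^*D)_jk is at most
   th |S| on finite sets; by the layer-cake decomposition this gives
   sum_jk (D^*D)_jk min(f_j, f_k) <= th sum_j f_j for f >= 0, and a
   Cheeger-type argument with f = y^2 yields |Dy|_2^2 <= c |y|_2^2 with c < 1
   when th < 1.  For p <> 2, put y = x^(p/2): on each row, Hoelder's and Young's
   inequalities give (Dx)_i^p <= kappa (Dy)_i^2 + (1 - kappa) (D y^2)_i with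
   kappa = min(1, p - 1), so that |Dx|_p^p <= (1 - kappa (1 - c)) |x|_p^p.  All
   of this is done on finite sets of rows and columns.  Conversely, u = D 1_S
   has values in [0, 1] and sum |S|, and sum_i u_i^2 = sum_(j,k in S) (D^*D)_jk;
   since u^p >= u - n (u - u^2) for an integer n >= p - 1, |u|_p^p is close to
   |S| as soon as |u|_2^2 is. *)
Require Import Defs.
From HB Require Import structures.
From mathcomp Require Import all_boot all_order all_algebra finmap.
From mathcomp Require Import all_classical all_reals ereal esum exp.
From mathcomp Require Import ring lra.

Import Order.TTheory GRing.Theory Num.Theory.
Local Open Scope classical_set_scope.
Local Open Scope ring_scope.

(** * Weighted Young, Hoelder and Jensen inequalities for finite sums *)

Lemma young_powR (R : realType) (s t a b : R) :
  0 < s -> 0 < t -> s + t = 1 -> 0 <= a -> 0 <= b ->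
  a `^ s * b `^ t <= s * a + t * b.
Proof.
move=> s0 t0 st a0 b0.
have := @conjugate_powR R (a `^ s) (b `^ t) s^-1 t^-1 (powR_ge0 _ _) (powR_ge0 _ _).
rewrite !invr_gt0 !invrK -!powRrM !mulfV ?gt_eqF// !powRr1//.
by move=> /(_ s0 t0 st); rewrite ![_ * s]mulrC ![_ * t]mulrC.
Qed.

(** Normalise [a] and [b] by their weighted sums, apply [young_powR] termwise and add up: the
    normalised sums are 1 and [s + t = 1]. *)
Lemma hoelder_sum (R : realType) (I : eqType) (r : seq I)
    (w a b : I -> R) (s t : R) :
  0 < s -> 0 < t -> s + t = 1 ->
  (forall i, 0 <= w i) -> (forall i, 0 <= a i) -> (forall i, 0 <= b i) ->
  \sum_(i <- r) w i * (a i `^ s * b i `^ t) <=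
  (\sum_(i <- r) w i * a i) `^ s * (\sum_(i <- r) w i * b i) `^ t.
Proof.
move=> s0 t0 st w0 a0 b0.
set A := \sum_(i <- r) w i * a i; set B := \sum_(i <- r) w i * b i.
have A0 : 0 <= A by apply: sumr_ge0 => i _; rewrite mulr_ge0.
have B0 : 0 <= B by apply: sumr_ge0 => i _; rewrite mulr_ge0.
have vanish (f : I -> R) : (forall i, 0 <= f i) -> \sum_(i <- r) w i * f i = 0 ->
    forall i, i \in r -> w i = 0 \/ f i = 0.
  move=> f0 /eqP; rewrite psumr_eq0; last by move=> i _; rewrite mulr_ge0.
  by move=> /allP + i ir => /(_ i ir)/=; rewrite mulf_eq0 => /orP[]/eqP; tauto.
have [A_eq0|A_neq0] := eqVneq A 0.
  rewrite big_seq big1 ?mulr_ge0 ?powR_ge0// => i ir.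
  have [->|->] := vanish a a0 A_eq0 i ir; first by rewrite mul0r.
  by rewrite powR0 ?gt_eqF// mul0r mulr0.
have [B_eq0|B_neq0] := eqVneq B 0.
  rewrite big_seq big1 ?mulr_ge0 ?powR_ge0// => i ir.
  have [->|->] := vanish b b0 B_eq0 i ir; first by rewrite mul0r.
  by rewrite [0 `^ t]powR0 ?gt_eqF// !mulr0.
have Agt : 0 < A by rewrite lt0r A_neq0.
have Bgt : 0 < B by rewrite lt0r B_neq0.
have step i : w i * (a i `^ s * b i `^ t) <=
    A `^ s * B `^ t * (s * ((w i * a i) / A) + t * ((w i * b i) / B)).
  have -> : a i `^ s * b i `^ t =
      A `^ s * B `^ t * ((a i / A) `^ s * (b i / B) `^ t).
    rewrite mulrACA -!powRM ?divr_ge0//.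
    by rewrite ![_ * (_ / _)]mulrC !divfK.
  rewrite mulrCA ler_wpM2l ?mulr_ge0 ?powR_ge0//.
  apply: (le_trans (ler_wpM2l (w0 i) (@young_powR R s t _ _ s0 t0 st _ _))).
  - by rewrite divr_ge0.
  - by rewrite divr_ge0.
  by rewrite le_eqVlt; apply/orP; left; apply/eqP; ring.
apply: (le_trans (ler_sum _ (fun i _ => step i))).
rewrite -mulr_sumr big_split/= -!mulr_sumr -!mulr_suml -/A -/B.
by rewrite !divff// !mulr1 st mulr1.
Qed.

(* [kappa] is the fraction of the variance of x^(p/2) that survives as a gap in
   Jensen's inequality for the p-th power. *)
Definition kappa {R : realType} (p : R) : R := Num.min 1 (p - 1).

(** With [X], [M], [V] the weighted sums of x, x^(p/2), x^p: for p >= 2, Hoelder against the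
    constant 1 gives X^p <= M^2. For p < 2, interpolating x between x^(p/2) and x^p gives X^p <=
    M^(2(p-1)) V^(2-p), and Young with weights p - 1 and 2 - p concludes. *)
Lemma jensen_gap (R : realType) (I : eqType) (r : seq I) (w x : I -> R) (p : R) :
  1 < p -> (forall i, 0 <= w i) -> \sum_(i <- r) w i <= 1 ->
  (forall i, 0 <= x i) ->
  (\sum_(i <- r) w i * x i) `^ p <=
  kappa p * (\sum_(i <- r) w i * x i `^ (p / 2)) ^+ 2 +
  (1 - kappa p) * \sum_(i <- r) w i * x i `^ p.
Proof.
move=> p1 w0 w1 x0; have p0 : 0 < p by lra.
set X := \sum_(i <- r) w i * x i; set M := \sum_(i <- r) w i * x i `^ (p / 2).
set V := \sum_(i <- r) w i * x i `^ p.
have M0 : 0 <= M by apply: sumr_ge0 => i _; rewrite mulr_ge0 ?powR_ge0.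
have X0 : 0 <= X by apply: sumr_ge0 => i _; rewrite mulr_ge0 ?powR_ge0.
have V0 : 0 <= V by apply: sumr_ge0 => i _; rewrite mulr_ge0 ?powR_ge0.
have [p2|p2] := leP 2 p.
  have -> : kappa p = 1 by rewrite /kappa min_l//; lra.
  rewrite mul1r subrr mul0r addr0.
  have XM : X <= M `^ (2 / p).
    (* At p = 2 the second Hoelder exponent 1 - 2/p would be 0, which [hoelder_sum] excludes. *)
    have [pe|pn] := eqVneq p 2.
      rewrite /M /X pe divff// powRr1; last first.
        by apply: sumr_ge0 => i _; rewrite mulr_ge0 ?powR_ge0.
      by under [leRHS]eq_bigr do rewrite powRr1//.
    have p2' : 2 < p by rewrite lt_neqAle eq_sym pn.
    have s0 : 0 < 2 / p by rewrite divr_gt0.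
    have t0 : 0 < 1 - 2 / p by rewrite subr_gt0 ltr_pdivrMr// mul1r.
    pose H := @hoelder_sum R I r w (fun i => x i `^ (p / 2)) (fun=> 1) _ _ s0 t0
      (subrKC _ _) w0 (fun i => powR_ge0 _ _) (fun=> ler01).
    apply: (le_trans _ (le_trans H _)).
      apply: ler_sum => i _; rewrite powR1 mulr1 -powRrM.
      by rewrite (_ : p / 2 * (2 / p) = 1) ?powRr1//; field; rewrite gt_eqF.
    rewrite -/M ler_piMr ?powR_ge0//.
    under eq_bigr do rewrite mulr1.
    apply: (le_trans (ge0_ler_powR (ltW t0) _ _ w1)); rewrite ?powR1 ?nnegrE//.
    by apply: sumr_ge0.
  apply: (le_trans (ge0_ler_powR (ltW p0) _ _ XM)); rewrite ?nnegrE ?powR_ge0//.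
  by rewrite -powRrM divfK ?gt_eqF// powR_mulrn.
have -> : kappa p = p - 1 by rewrite /kappa min_r//; lra.
have p_sub1 : 0 < p - 1 by lra.
have p_sub2 : 0 < 2 - p by lra.
have sum1 : p - 1 + (2 - p) = 1 by ring.
have s0 : 0 < 2 * (p - 1) / p by rewrite divr_gt0//; lra.
have t0 : 0 < (2 - p) / p by rewrite divr_gt0//; lra.
have st : 2 * (p - 1) / p + (2 - p) / p = 1 by field; rewrite gt_eqF.
have XM : X <= M `^ (2 * (p - 1) / p) * V `^ ((2 - p) / p).
  apply: le_trans (@hoelder_sum R I r w _ _ _ _ s0 t0 st w0 _ _).
  - apply: ler_sum => i _; rewrite ler_wpM2l// -!powRrM -powRD; last first.
      by apply/implyP => /eqP; lra.
    rewrite (_ : _ + _ = 1) ?powRr1//; field; rewrite gt_eqF//.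
  - by move=> i; exact: powR_ge0.
  - by move=> i; exact: powR_ge0.
clearbody X M V.
apply: (le_trans (ge0_ler_powR (ltW p0) _ _ XM)).
- by rewrite nnegrE.
- by rewrite nnegrE mulr_ge0 ?powR_ge0.
have p_neq0 : p != 0 by rewrite gt_eqF.
rewrite (powRM _ (powR_ge0 _ _) (powR_ge0 _ _)) -!powRrM !(divfK p_neq0).
rewrite powRrM powR_mulrn// (_ : 1 - (p - 1) = 2 - p); last by ring.
exact: young_powR p_sub1 p_sub2 sum1 (sqr_ge0 M) V0.
Qed.

(** * Layer-cake decomposition and the Cheeger-type constant *)

(** Peel off one layer at a time: with m the minimum of f on S, attained at [j0], the constant m
    contributes at most th m |S| by hypothesis, and f - m vanishes at [j0], so the induction
    continues on S without [j0]. *)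
Lemma sum_fset_min_le (R : realType) (I : choiceType) (b : I -> I -> R) (th : R) :
  (forall S : {fset I}, \sum_(j <- S) \sum_(k <- S) b j k <= th * #|` S|%:R) ->
  forall (S : {fset I}) (f : I -> R), (forall i, i \in S -> 0 <= f i) ->
  \sum_(j <- S) \sum_(k <- S) b j k * Num.min (f j) (f k) <=
  th * \sum_(j <- S) f j.
Proof.
move=> bth S; have [n] := ubnP #|` S|; elim: n S => // n IH S Sn f f0.
have [->|/fset0Pn[i0 i0S]] := eqVneq S fset0.
  by rewrite !big_seq_fset0 mulr0.
have [j0 j0S f_min] : exists2 j, j \in S & forall k, k \in S -> f j <= f k.
  pose i1 : S := [` i0S]%fset.
  case: (@arg_minP _ _ _ i1 xpredT (fun i : S => f (val i)) isT) => j _ jmin.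
  exists (val j); first exact: valP.
  by move=> k kS; exact: (jmin [` kS]%fset isT).
pose m := f j0; pose g i := f i - m.
have g0 i : i \in S -> 0 <= g i by move=> iS; rewrite subr_ge0 f_min.
have gj0 : g j0 = 0 by rewrite /g subrr.
have minE j k : Num.min (f j) (f k) = m + Num.min (g j) (g k).
  by rewrite addr_minr /g ![m + _]addrC !subrK.
have fE : \sum_(j <- S) f j = m * #|` S|%:R + \sum_(j <- (S `\ j0)%fset) g j.
  rewrite -[\sum_(j <- _) g j]add0r -{2}gj0 -big_fsetD1//=.
  by rewrite sumrB big_const_seq count_predT iter_addr_0 mulr_natr addrC subrK.
rewrite fE mulrDr.
have -> : \sum_(j <- S) \sum_(k <- S) b j k * Num.min (f j) (f k) =
   m * (\sum_(j <- S) \sum_(k <- S) b j k) +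
   \sum_(j <- (S `\ j0)%fset) \sum_(k <- (S `\ j0)%fset) b j k * Num.min (g j) (g k).
  have drop_j0 j : j \in S -> \sum_(k <- S) b j k * Num.min (g j) (g k) =
      \sum_(k <- (S `\ j0)%fset) b j k * Num.min (g j) (g k).
    by move=> jS; rewrite (big_fsetD1 j0)//= gj0 min_r ?g0// mulr0 add0r.
  rewrite mulr_sumr; under eq_bigr do under eq_bigr do rewrite minE mulrDr.
  under eq_bigr do rewrite big_split/= -mulr_suml mulrC.
  rewrite big_split/=; congr (_ + _).
  rewrite (big_fsetD1 j0)//= big_seq big1 ?add0r => [|k kS]; last first.
    by rewrite gj0 min_l ?g0// mulr0.
  by rewrite big_seq [RHS]big_seq; apply: eq_bigr => j /fsetD1P[_ /drop_j0].
rewrite mulrCA lerD ?ler_wpM2l ?f0//.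
apply: IH => [|i]; last by rewrite !inE => /andP[_ /g0].
by move: Sn; rewrite (cardfsD1 j0 S) j0S.
Qed.

(* Square of the l^2 norm bound obtained from Theta(D^*D) <= th; it comes from
   2 min(a,b) max(a,b) <= nu min(a,b)^2 + max(a,b)^2 / nu with nu = 2 - th. *)
Definition cheeger {R : realType} (th : R) : R :=
  (th * ((2 - th) ^+ 2 - 1) + 2) / (2 * (2 - th)).

Lemma cheeger_ge0 (R : realType) (th : R) : 0 <= th <= 1 -> 0 <= cheeger th.
Proof.
move=> /andP[th0 th1]; rewrite divr_ge0//; last by lra.
rewrite (_ : _ + 2 = th * (1 - th) * (3 - th) + 2); last by ring.
by rewrite addr_ge0// !mulr_ge0//; lra.
Qed.

(** After clearing the denominator, the gap 1 - [cheeger th] is (1 - th)^2 / 2. *)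
Lemma cheeger_le1 (R : realType) (th : R) : 0 <= th <= 1 -> cheeger th <= 1.
Proof.
move=> /andP[th0 th1]; have nu0 : 0 < 2 * (2 - th) by lra.
rewrite /cheeger ler_pdivrMr// -subr_ge0.
rewrite (_ : _ - _ = (1 - th) ^+ 2 * (2 - th)); last by ring.
by rewrite mulr_ge0 ?sqr_ge0//; lra.
Qed.

Lemma cheeger_lt1 (R : realType) (th : R) : 0 <= th < 1 -> cheeger th < 1.
Proof.
move=> /andP[th0 th1]; have nu0 : 0 < 2 * (2 - th) by lra.
rewrite /cheeger ltr_pdivrMr// -subr_gt0.
rewrite (_ : _ - _ = (1 - th) ^+ 2 * (2 - th)); last by ring.
by rewrite mulr_gt0 ?exprn_gt0//; lra.
Qed.

(** The maximum is eliminated through min + max = a^2 + b^2, so that only the minimum and the two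
    separate squares have to be summed against a kernel. *)
Lemma mul_le_min_sqr (R : realType) (nu a b : R) :
  1 <= nu -> 0 <= a -> 0 <= b ->
  a * b <= (nu - nu^-1) / 2 * Num.min (a ^+ 2) (b ^+ 2) +
           (a ^+ 2 + b ^+ 2) / (2 * nu).
Proof.
move=> nu1.
wlog ab : a b / a <= b => [hw a0 b0|a0 b0].
  have [/hw|/ltW/hw] := leP a b; first exact.
  by move=> /(_ b0 a0); rewrite mulrC minC addrC [b ^+ 2 + _]addrC addrC.
rewrite min_l ?ler_pXn2r// ?nnegrE//.
have nu0 : nu != 0 by rewrite gt_eqF//; lra.
rewrite -subr_ge0.
have -> : (nu - nu^-1) / 2 * a ^+ 2 + (a ^+ 2 + b ^+ 2) / (2 * nu) - a * b =
  (nu * a - b) ^+ 2 / (2 * nu) by field.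
by rewrite divr_ge0 ?sqr_ge0//; lra.
Qed.

(** The convex combination [kappa p] [cheeger th] + (1 - [kappa p]); it will bound the p-th power of
    the operator norm. *)
Definition contraction {R : realType} (th p : R) : R :=
  1 - kappa p * (1 - cheeger th).

Lemma contraction_ge0 (R : realType) (th p : R) :
  0 <= th <= 1 -> 1 < p -> 0 <= contraction th p.
Proof.
move=> th01 p1; rewrite subr_ge0 mulr_ile1//.
- by rewrite /kappa le_min; lra.
- by rewrite subr_ge0 cheeger_le1.
- by rewrite /kappa ge_min lexx.
- by rewrite gerBl cheeger_ge0.
Qed.

(** * Contraction estimates on finitely many rows and columns *)

Section finite_truncation.
Variables (R : realType) (I : choiceType) (D : I -> I -> R) (th : R).
Hypothesis D_ge0 : forall i j, 0 <= D i j.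
Hypothesis row_le1 : forall i (S : {fset I}), \sum_(j <- S) D i j <= 1.
Hypothesis col_le1 : forall j (T : {fset I}), \sum_(i <- T) D i j <= 1.
Hypothesis th_01 : 0 <= th <= 1.
Variable T : {fset I}.
Hypothesis gram_le : forall S : {fset I},
  \sum_(j <- S) \sum_(k <- S) \sum_(i <- T) D i j * D i k <= th * #|` S|%:R.

(** The left side is the quadratic form of the truncated Gram matrix [G]. After [mul_le_min_sqr],
    the minimum is controlled by [sum_fset_min_le] and the squares by the row sums of [G]. *)
Lemma sum_sqr_le (S : {fset I}) (y : I -> R) : (forall j, 0 <= y j) ->
  \sum_(i <- T) (\sum_(j <- S) D i j * y j) ^+ 2 <=
  cheeger th * \sum_(j <- S) y j ^+ 2.
Proof.
move=> y0; pose G j k := \sum_(i <- T) D i j * D i k.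
have G0 j k : 0 <= G j k by apply: sumr_ge0 => i _; rewrite mulr_ge0.
have Gsym j k : G j k = G k j by apply: eq_bigr => i _; rewrite mulrC.
have Grow j : \sum_(k <- S) G j k <= 1.
  rewrite exchange_big/=; apply: le_trans (col_le1 j T).
  by apply: ler_sum => i _; rewrite -mulr_sumr ler_piMr.
have -> : \sum_(i <- T) (\sum_(j <- S) D i j * y j) ^+ 2 =
    \sum_(j <- S) \sum_(k <- S) G j k * (y j * y k).
  under [RHS]eq_bigr do under eq_bigr do rewrite mulr_suml.
  under [RHS]eq_bigr do rewrite exchange_big/=.
  rewrite exchange_big/=; apply: eq_bigr => i _.
  rewrite expr2 mulr_suml; apply: eq_bigr => j _; rewrite mulr_sumr.
  by apply: eq_bigr => k _; rewrite mulrACA.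
(* The final constant is th (nu - 1/nu) / 2 + 1/nu, which this choice of [nu] turns into
   [cheeger th]. *)
pose nu := 2 - th; have nu1 : 1 <= nu by move: th_01; rewrite /nu; lra.
have nu0 : 0 < nu by lra.
set F := \sum_(j <- S) y j ^+ 2.
have Gmin : \sum_(j <- S) \sum_(k <- S) G j k * Num.min (y j ^+ 2) (y k ^+ 2) <=
    th * F.
  by apply: (@sum_fset_min_le R I G th gram_le S (fun j => y j ^+ 2)) => j _;
     rewrite sqr_ge0.
have Gl : \sum_(j <- S) \sum_(k <- S) G j k * y j ^+ 2 <= F.
  by apply: ler_sum => j _; rewrite -mulr_suml ler_piMl ?sqr_ge0.
have Gr : \sum_(j <- S) \sum_(k <- S) G j k * y k ^+ 2 <= F.
  rewrite exchange_big/=; under eq_bigr do under eq_bigr do rewrite Gsym.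
  exact: Gl.
have step j k : G j k * (y j * y k) <=
    (nu - nu^-1) / 2 * (G j k * Num.min (y j ^+ 2) (y k ^+ 2)) +
    (2 * nu)^-1 * (G j k * y j ^+ 2 + G j k * y k ^+ 2).
  apply: (le_trans (ler_wpM2l (G0 j k) (mul_le_min_sqr _ nu _ _ nu1 (y0 j) (y0 k)))).
  by rewrite le_eqVlt; apply/orP; left; apply/eqP; field; rewrite gt_eqF.
apply: (le_trans (ler_sum _ (fun j _ => ler_sum _ (fun k _ => step j k)))).
under eq_bigr do rewrite big_split/= -!mulr_sumr big_split/=.
rewrite big_split/= -!mulr_sumr big_split/=.
have c1 : 0 <= (nu - nu^-1) / 2.
  by rewrite divr_ge0// subr_ge0 (le_trans _ nu1)// invf_le1.
have c2 : 0 <= (2 * nu)^-1 by rewrite invr_ge0; lra.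
apply: (le_trans (lerD (ler_wpM2l c1 Gmin) (ler_wpM2l c2 (lerD Gl Gr)))).
rewrite le_eqVlt; apply/orP; left; apply/eqP; rewrite /cheeger -/nu.
rewrite (_ : th = 2 - nu); last by rewrite /nu; ring.
by field; rewrite ?gt_eqF//.
Qed.

(** Apply [jensen_gap] to each row; the squared sums are handled by [sum_sqr_le] with y = x^(p/2),
    the remaining term by the column sums. *)
Lemma sum_powR_le (p : R) (S : {fset I}) (x : I -> R) :
  1 < p -> (forall j, 0 <= x j) ->
  \sum_(i <- T) (\sum_(j <- S) D i j * x j) `^ p <=
  contraction th p * \sum_(j <- S) x j `^ p.
Proof.
move=> p1 x0.
have k0 : 0 <= kappa p by rewrite /kappa le_min; lra.
have k1 : 0 <= 1 - kappa p by rewrite /kappa subr_ge0 ge_min lexx.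
apply: (le_trans (ler_sum _ (fun i _ =>
  @jensen_gap R I S (D i) x p p1 (D_ge0 i) (row_le1 i S) x0))).
rewrite big_split/= -!mulr_sumr.
have V : \sum_(i <- T) \sum_(j <- S) D i j * x j `^ p <= \sum_(j <- S) x j `^ p.
  rewrite exchange_big/=; apply: ler_sum => j _.
  by rewrite -mulr_suml ler_piMl ?powR_ge0.
have M := sum_sqr_le S (fun j => x j `^ (p / 2)) (fun j => powR_ge0 _ _).
have sq j : (x j `^ (p / 2)) ^+ 2 = x j `^ p.
  by rewrite -powR_mulrn ?powR_ge0// -powRrM divfK.
rewrite (eq_bigr _ (fun j _ => sq j)) in M.
apply: (le_trans (lerD (ler_wpM2l k0 M) (ler_wpM2l k1 V))).
by rewrite /contraction le_eqVlt; apply/orP; left; apply/eqP; ring.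
Qed.

End finite_truncation.

Lemma powR_lt1 (R : realType) (a r : R) : 0 <= a < 1 -> 0 < r -> a `^ r < 1.
Proof.
move=> /andP[a0 a1] r0; have := gt0_ltr_powR r0 _ _ a1.
by rewrite powR1; apply; rewrite nnegrE.
Qed.

(** * Unordered sums through finite partial sums *)

Section esum_fset.
Context {R : realType} {I : choiceType}.
Implicit Types (a : I -> \bar R) (z : I -> R) (S : {fset I}).

Lemma fsbig_fset S a : (\sum_(i \in [set` S]) a i = \sum_(i <- S) a i)%E.
Proof. by rewrite fsbig_finite//= set_fsetK. Qed.

Lemma sum_fset_le_esum S a : (\sum_(i <- S) a i <= \esum_(i in [set: I]) a i)%E.
Proof.
by apply: esum_ge; exists [set` S]; rewrite ?fsbig_fset//; split.
Qed.

Lemma ge_esum_fset a (c : \bar R) :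
  (forall S, \sum_(i <- S) a i <= c)%E -> (\esum_(i in [set: I]) a i <= c)%E.
Proof.
move=> ac; apply: ge_ereal_sup => _ [X [finX _] <-].
by rewrite fsbig_finite.
Qed.

Lemma lt_esum_fset a (c : \bar R) : (c < \esum_(i in [set: I]) a i)%E ->
  exists S, (c < \sum_(i <- S) a i)%E.
Proof.
move=> /ereal_sup_gt[_ [X [finX _] <-]]; rewrite fsbig_finite// => cX.
by exists (fset_set X).
Qed.

Lemma ge0_esumZl a (c : R) : 0 <= c -> (forall i, 0 <= a i)%E ->
  (\esum_(i in [set: I]) (c%:E * a i) = c%:E * (\esum_(i in [set: I]) a i))%E.
Proof.
move=> c0 a0; apply/eqP; rewrite eq_le; apply/andP; split.
  apply: ge_esum_fset => S; rewrite -ge0_sume_distrr; last by move=> i _; exact: a0.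
  by rewrite lee_wpmul2l ?lee_fin// sum_fset_le_esum.
(* For c = 0 both sides are 0, even for an infinite sum, as 0 times +oo is 0; otherwise divide by
   c. *)
have [<-|c_neq0] := eqVneq 0 c.
  by rewrite mul0e; apply: esum_ge0 => i _; rewrite mul0e.
have cgt0 : 0 < c by rewrite lt0r eq_sym c_neq0.
rewrite -lee_pdivlMl//; apply: ge_esum_fset => S; rewrite lee_pdivlMl//.
rewrite ge0_sume_distrr; last by move=> i _; exact: a0.
exact: sum_fset_le_esum.
Qed.

Lemma sum_fset_le1 S z : (\esum_(i in [set: I]) (z i)%:E = 1)%E ->
  \sum_(i <- S) z i <= 1.
Proof.
by move=> z1; rewrite -lee_fin -sumEFin -[leRHS]z1 sum_fset_le_esum.
Qed.

Lemma rsum_ge0E z : (forall i, 0 <= z i) ->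
  rsum z = fine (\esum_(i in [set: I]) (z i)%:E).
Proof.
move=> z0; rewrite /rsum [X in _ - fine X]esum1 ?subr0 => [|i _]; last first.
  by rewrite max_r// oppr_le0.
by congr fine; apply: eq_esum => i _; rewrite max_l.
Qed.

(** If the positive or negative part has infinite sum, [fine] replaces it by 0, but the right side
    is then +oo; otherwise this is the triangle inequality. *)
Lemma norm_rsum_le z : (`|rsum z|%:E <= \esum_(i in [set: I]) `|z i|%:E)%E.
Proof.
rewrite /rsum; set P := (\esum_(i in _) _)%E; set N := (\esum_(i in _) _)%E.
have P0 : (0 <= P)%E by apply: esum_ge0 => i _; rewrite lee_fin le_max lexx orbT.
have N0 : (0 <= N)%E by apply: esum_ge0 => i _; rewrite lee_fin le_max lexx orbT.
have -> : (\esum_(i in [set: I]) `|z i|%:E = P + N)%E.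
  rewrite -esumD; last 2 first.
  - by move=> i _; rewrite lee_fin le_max lexx orbT.
  - by move=> i _; rewrite lee_fin le_max lexx orbT.
  apply: eq_esum => i _; rewrite -EFinD; congr EFin.
  have [zi|zi] := leP 0 (z i).
    by rewrite ger0_norm// max_r ?addr0// oppr_le0.
  by rewrite ltr0_norm// max_l ?add0r// oppr_ge0 ltW.
case: P P0 => [P| |]//= P0; last by rewrite addye ?leey// -ltNye (lt_le_trans _ N0).
case: N N0 => [N| |]//= N0; last by rewrite addey ?leey.
rewrite -EFinD lee_fin; rewrite !lee_fin in P0 N0.
by rewrite (le_trans (ler_normB _ _))// !ger0_norm.
Qed.

End esum_fset.

(** * Quotients of l^p norms, and a lower bound for powers on [0, 1] *)

(** A nonzero x in l^p has a finite positive norm, so the extended-real quotient is a genuine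
    division and both sides can be raised to the power p; the norm of y may be +oo. *)
Lemma lp_norm_div_le (R : realType) (I : choiceType) (p m : R) (x y : I -> R) :
  0 < p -> 0 <= m -> lp_space p x -> x <> (fun=> 0) ->
  (lp_norm p y / lp_norm p x <= m%:E)%E =
  (\esum_(i in [set: I]) (`|y i| `^ p)%:E <=
    (m `^ p)%:E * (\esum_(i in [set: I]) (`|x i| `^ p)%:E))%E.
Proof.
move=> p0 m0 xlp x_neq0; rewrite /lp_norm.
set N := (\esum_(i in _) (`|y i| `^ p)%:E)%E; move: xlp; rewrite /lp_space/=.
set E := (\esum_(i in _) (`|x i| `^ p)%:E)%E => Elt.
have N0 : (0 <= N)%E by apply: esum_ge0 => i _; rewrite lee_fin powR_ge0.
have E0 : (0 < E)%E.
  have /existsNP[i /eqP xi] : ~ forall i, x i = 0.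
    by move=> x_eq0; apply: x_neq0; apply/funext.
  apply: lt_le_trans (sum_fset_le_esum [fset i]%fset _).
  by rewrite big_seq_fset1 lte_fin powR_gt0 ?normr_gt0.
clearbody N E; case: E E0 Elt => [e| |]//; rewrite lte_fin => e0 _.
have q0 : 0 < p^-1 by rewrite invr_gt0.
have pK (z : \bar R) : (0 <= z)%E -> ((z `^ p^-1) `^ p = z)%E.
  by move=> z0; rewrite -poweRrM mulVf ?gt_eqF// poweRe1.
have eq0 : 0 < e `^ p^-1 by rewrite powR_gt0.
rewrite poweR_EFin inver gt_eqF// lee_pdivrMr// -EFinM.
have rhsE : (m `^ p * e)%:E = ((m * e `^ p^-1)%:E `^ p)%E.
  rewrite poweR_EFin powRM ?powR_ge0// -powRrM mulVf ?gt_eqF// powRr1//.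
  exact: ltW.
have me0 : 0 <= m * e `^ p^-1 by rewrite mulr_ge0// ltW.
rewrite -EFinM rhsE; apply/idP/idP => [h|h].
  rewrite -(pK N N0); apply: gt0_ler_poweR h; first exact: ltW.
  - by rewrite in_itv/= poweR_ge0 leey.
  - by rewrite in_itv/= lee_fin me0 leey.
have : (N `^ p^-1 <= ((m * e `^ p^-1)%:E `^ p) `^ p^-1)%E.
  apply: gt0_ler_poweR h; first exact: ltW.
  - by rewrite in_itv/= N0 leey.
  - by rewrite in_itv/= leey andbT lee_fin powR_ge0.
by rewrite -(poweRrM _ p) mulfV ?gt_eqF// poweRe1 ?lee_fin.
Qed.

(* u^p >= u^(n+1), and Bernoulli's inequality u^n >= 1 - n(1 - u). *)
Lemma powR_bernoulli (R : realType) (u p : R) (n : nat) :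
  0 <= u <= 1 -> 0 < p <= n.+1%:R ->
  u + n%:R * u ^+ 2 <= u `^ p + n%:R * u.
Proof.
move=> /andP[u0 u1] /andP[p0 pn].
have bern : 1 - n%:R * (1 - u) <= u ^+ n.
  elim: n {pn} => [|n IH]; first by rewrite mul0r subr0.
  rewrite exprSr; apply: le_trans (ler_wpM2r u0 IH).
  rewrite -subr_ge0 (_ : _ - _ = n%:R * (1 - u) ^+ 2) ?mulr_ge0 ?subr_ge0//.
  by rewrite -natr1; ring.
apply: (@le_trans _ _ (u ^+ n.+1 + n%:R * u)).
  rewrite -subr_ge0.
  rewrite (_ : _ - _ = u * (u ^+ n - (1 - n%:R * (1 - u)))); last first.
    by rewrite exprS; ring.
  by rewrite mulr_ge0// subr_ge0.
rewrite lerD2r -powR_mulrn//; have [->|un0] := eqVneq u 0.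
  by rewrite !powR0// gt_eqF.
by apply: ger_powR => //; rewrite u1 lt0r un0 u0.
Qed.

(** * Quantitative bounds between the operator norm and Theta *)

Section doubly_stochastic_operator.
Variables (R : realType) (I : choiceType) (D : I -> I -> R).
Hypothesis D_ds : doubly_stochastic D.

Let D_ge0 i j : 0 <= D i j. Proof. by case: D_ds. Qed.
Let row_esum i : (\esum_(k in [set: I]) (D i k)%:E = 1)%E.
Proof. by case: D_ds. Qed.
Let col_esum j : (\esum_(k in [set: I]) (D k j)%:E = 1)%E.
Proof. by case: D_ds. Qed.
Let row_le1 i (S : {fset I}) : \sum_(j <- S) D i j <= 1.
Proof. exact: sum_fset_le1. Qed.
Let col_le1 j (T : {fset I}) : \sum_(i <- T) D i j <= 1.
Proof. exact: (sum_fset_le1 T (fun i => D i j)). Qed.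

Let Gram := opmul (adjoint D) D.

Let D_le1 i j : D i j <= 1.
Proof. by have := row_le1 i [fset j]%fset; rewrite big_seq_fset1. Qed.

(** As D i k <= 1, the sum is at most the j-th column sum 1; being finite, it is unchanged by the
    [fine] inside [rsum]. *)
Lemma EFin_gram j k :
  ((Gram j k)%:E = \esum_(i in [set: I]) (D i j * D i k)%:E)%E.
Proof.
rewrite /Gram /opmul /adjoint rsum_ge0E => [|i]; last by rewrite mulr_ge0.
rewrite fineK// ge0_fin_numE; last first.
  by apply: esum_ge0 => i _; rewrite lee_fin mulr_ge0.
apply: (@le_lt_trans _ _ 1%E); last exact: ltry.
by rewrite -(col_esum j); apply: le_esum => i _; rewrite lee_fin ler_piMr.
Qed.

(** This is the identity between the form of D^*D at the indicator of S and |D 1_S|_2^2; finite and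
    unordered sums of nonnegative terms commute. *)
Lemma sum_gram_EFin (S : {fset I}) :
  ((\sum_(j <- S) \sum_(k <- S) Gram j k)%:E =
   \esum_(i in [set: I]) ((\sum_(j <- S) D i j) ^+ 2)%:E)%E.
Proof.
transitivity (\sum_(j <- S) \sum_(k <- S)
    \esum_(i in [set: I]) (D i j * D i k)%:E)%E.
  rewrite -sumEFin; apply: eq_bigr => j _; rewrite -sumEFin.
  by apply: eq_bigr => k _; rewrite EFin_gram.
transitivity (\sum_(j <- S)
    \esum_(i in [set: I]) \sum_(k <- S) (D i j * D i k)%:E)%E.
  by apply: eq_bigr => j _; rewrite esum_sum// => i k _ _; rewrite lee_fin mulr_ge0.
rewrite -esum_sum => [|i j _ _]; last first.
  by apply: sume_ge0 => k _; rewrite lee_fin mulr_ge0.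
apply: eq_esum => i _; rewrite expr2 mulr_suml -sumEFin.
by apply: eq_bigr => j _; rewrite mulr_sumr -sumEFin.
Qed.

Lemma esum_sum_col (S : {fset I}) :
  (\esum_(i in [set: I]) (\sum_(j <- S) D i j)%:E = #|` S|%:R%:E)%E.
Proof.
under eq_esum do rewrite -sumEFin.
rewrite esum_sum; last by move=> i j _ _; rewrite lee_fin.
under eq_bigr do rewrite col_esum.
by rewrite sumEFin big_const_seq count_predT iter_addr_0.
Qed.

(** The entries u_i of D 1_S lie in [0, 1], so u_i^2 <= u_i, and the u_i add up to |S|. *)
Lemma sum_gram_le_card (S : {fset I}) :
  \sum_(j <- S) \sum_(k <- S) Gram j k <= #|` S|%:R.
Proof.
rewrite -lee_fin sum_gram_EFin -esum_sum_col; apply: le_esum => i _.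
by rewrite lee_fin expr2 ler_piMl// sumr_ge0.
Qed.

Lemma Theta_le (m : R) :
  (forall S : {fset I}, \sum_(j <- S) \sum_(k <- S) Gram j k <= m * #|` S|%:R) ->
  (Theta Gram <= m%:E)%E.
Proof.
move=> Gm; apply: ge_ereal_sup => _ [S S0 <-]; rewrite lee_fin.
by rewrite ler_pdivrMl ?ltr0n ?cardfs_gt0// mulrC.
Qed.

Lemma sum_gram_le_Theta (m : R) (S : {fset I}) : (Theta Gram <= m%:E)%E ->
  \sum_(j <- S) \sum_(k <- S) Gram j k <= m * #|` S|%:R.
Proof.
move=> Tm; have [->|S0] := eqVneq S fset0.
  by rewrite !big_seq_fset0 cardfs0 mulr0.
rewrite mulrC -ler_pdivrMl ?ltr0n ?cardfs_gt0// -lee_fin (le_trans _ Tm)//.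
by apply: ereal_sup_ubound; exists S.
Qed.

Lemma gram_trunc_le (T : {fset I}) j k : \sum_(i <- T) D i j * D i k <= Gram j k.
Proof. by rewrite -lee_fin EFin_gram -sumEFin sum_fset_le_esum. Qed.

Lemma esum_opact_le (p th : R) (x : I -> R) : 1 < p -> 0 <= th <= 1 ->
  (forall S : {fset I}, \sum_(j <- S) \sum_(k <- S) Gram j k <= th * #|` S|%:R) ->
  (\esum_(i in [set: I]) (`|opact D x i| `^ p)%:E <=
   (contraction th p)%:E * (\esum_(j in [set: I]) (`|x j| `^ p)%:E))%E.
Proof.
move=> p1 th01 Gth; have p0 : 0 < p by lra.
have c0 : 0 <= contraction th p by exact: contraction_ge0.
apply: ge_esum_fset => T.
(* Each |Dx|_i is at most a supremum of finite sums, so up to a factor lam < 1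
   all the rows in T are reached by one finite set S of columns. *)
have trunc (lam : R) : 0 < lam < 1 -> exists S : {fset I}, forall i, i \in T ->
    lam * `|opact D x i| <= \sum_(j <- S) D i j * `|x j|.
  move=> /andP[lam0 lam1].
  have row i : exists S : {fset I},
      lam * `|opact D x i| <= \sum_(j <- S) D i j * `|x j|.
    (* The factor [lam] yields the strict inequality needed to extract a finite set only when the
       entry is nonzero. *)
    have [Dx0|Dx0] := eqVneq (opact D x i) 0.
      by exists fset0; rewrite Dx0 normr0 mulr0 big_seq_fset0.
    have : ((lam * `|opact D x i|)%:E <
        \esum_(j in [set: I]) `|(D i j * x j)%R|%:E)%E.
      apply: lt_le_trans (norm_rsum_le (fun j => D i j * x j)).
      by rewrite lte_fin gtr_pMl// normr_gt0.
    move=> /lt_esum_fset[S]; rewrite sumEFin lte_fin => /ltW DxS; exists S.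
    by under eq_bigr do rewrite -[D i _]ger0_norm// -normrM.
  pose S i := sval (cid (row i)).
  exists (\bigcup_(i <- T) S i)%fset => i iT.
  apply: (le_trans (svalP (cid (row i)))); rewrite -/(S i) -lee_fin -!sumEFin.
  apply: lee_sum_nneg_subfset => [j jS|j _ _].
    by apply/bigfcupP; exists i; rewrite ?iT.
  by rewrite lee_fin mulr_ge0.
(* It suffices to bound mu times the left side for every 0 < mu < 1; [lam] is chosen with lam^p =
   mu. *)
apply/lee_mul01Pr; first by apply: sume_ge0 => i _; rewrite lee_fin powR_ge0.
move=> mu /andP[mu0 mu1]; pose lam := mu `^ p^-1.
have lam0 : 0 < lam by rewrite powR_gt0.
have lamp : lam `^ p = mu by rewrite -powRrM mulVf ?gt_eqF// powRr1 ?ltW.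
have lam1 : lam < 1 by rewrite powR_lt1 ?invr_gt0// mu1 ltW.
have [S TS] := trunc lam (introT andP (conj lam0 lam1)).
apply: (@le_trans _ _ (contraction th p * \sum_(j <- S) `|x j| `^ p)%:E); last first.
  by rewrite EFinM lee_wpmul2l ?lee_fin// -sumEFin sum_fset_le_esum.
rewrite sumEFin -EFinM lee_fin.
have gramT (S' : {fset I}) :
    \sum_(j <- S') \sum_(k <- S') \sum_(i <- T) D i j * D i k <=
    th * #|` S'|%:R.
  apply: le_trans (Gth S'); apply: ler_sum => j _; apply: ler_sum => k _.
  exact: gram_trunc_le.
apply: le_trans (sum_powR_le R I D th D_ge0 row_le1 col_le1 th01 T gramT p S
  (fun j => `|x j|) p1 (fun j => normr_ge0 _)).
rewrite mulr_sumr big_seq [leRHS]big_seq; apply: ler_sum => i iT.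
have lamDx0 : 0 <= lam * `|opact D x i| by rewrite mulr_ge0 ?(ltW lam0).
have sum0 : 0 <= \sum_(j <- S) D i j * `|x j|.
  by apply: sumr_ge0 => j _; rewrite mulr_ge0.
rewrite -lamp -powRM ?(ltW lam0)//.
by apply: ge0_ler_powR; [exact: ltW|rewrite nnegrE|rewrite nnegrE|exact: TS].
Qed.

Lemma lp_opnorm_le (p th : R) : 1 < p -> 0 <= th <= 1 ->
  (forall S : {fset I}, \sum_(j <- S) \sum_(k <- S) Gram j k <= th * #|` S|%:R) ->
  (lp_opnorm p (opact D) <= (contraction th p `^ p^-1)%:E)%E.
Proof.
move=> p1 th01 Gth; have p0 : 0 < p by lra.
apply: ge_ereal_sup => _ [x [xlp x0] <-].
rewrite lp_norm_div_le ?powR_ge0// -powRrM mulVf ?gt_eqF//.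
by rewrite powRr1 ?contraction_ge0//; exact: esum_opact_le.
Qed.

(** The operator norm is tested on the indicator of S, whose p-th power sum is at most |S|. *)
Lemma esum_indic_le (p m : R) (S : {fset I}) : 1 < p -> 0 <= m ->
  (lp_opnorm p (opact D) <= m%:E)%E -> S != fset0 ->
  (\esum_(i in [set: I]) ((\sum_(j <- S) D i j) `^ p)%:E <=
   (m `^ p * #|` S|%:R)%:E)%E.
Proof.
move=> p1 m0 Dm /fset0Pn[i0 i0S]; have p0 : 0 < p by lra.
pose x (j : I) : R := (j \in S)%:R.
have x0 j : 0 <= x j by rewrite ler0n.
have x_card : (\esum_(j in [set: I]) (`|x j| `^ p)%:E <= #|` S|%:R%:E)%E.
  apply: ge_esum_fset => T; rewrite sumEFin lee_fin.
  have -> : \sum_(j <- T) `|x j| `^ p = (count (mem S) T)%:R.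
    rewrite -sum1_count [in RHS]big_mkcond [RHS]natr_sum; apply: eq_bigr => j _.
    rewrite ger0_norm// /x inE/=; case: (j \in S); first by rewrite powR1.
    by rewrite powR0// gt_eqF.
  rewrite ler_nat -size_filter uniq_leq_size ?filter_uniq ?fset_uniq// => j.
  by rewrite mem_filter => /andP[].
have xlp : lp_space p x by apply: le_lt_trans x_card _; exact: ltry.
have x_neq0 : x <> (fun=> 0).
  by move=> /(congr1 (@^~ i0))/eqP; rewrite /x i0S oner_eq0.
have : (lp_norm p (opact D x) / lp_norm p x <= m%:E)%E.
  by apply: le_trans Dm; apply: ereal_sup_ubound; exists x.
rewrite lp_norm_div_le// => Dx.
apply: (@le_trans _ _ (\esum_(i in [set: I]) (`|opact D x i| `^ p)%:E)%E).
  apply: le_esum => i _; rewrite lee_fin.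
  apply: ge0_ler_powR; rewrite ?(ltW p0) ?nnegrE ?sumr_ge0 ?normr_ge0//.
  apply: le_trans (ler_norm _); rewrite /opact rsum_ge0E; last first.
    by move=> j; rewrite mulr_ge0.
  rewrite -lee_fin fineK; last first.
    rewrite ge0_fin_numE; last by apply: esum_ge0 => j _; rewrite lee_fin mulr_ge0.
    apply: (@le_lt_trans _ _ 1%E); last exact: ltry.
    rewrite -(row_esum i); apply: le_esum => j _; rewrite lee_fin ler_piMr//.
    by rewrite /x lern1 leq_b1.
  apply: le_trans (sum_fset_le_esum S _).
  rewrite sumEFin lee_fin big_seq [leRHS]big_seq; apply: ler_sum => j jS.
  by rewrite /x jS mulr1.
by apply: (le_trans Dx); rewrite EFinM lee_wpmul2l ?lee_fin ?powR_ge0.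
Qed.

(** Sum [powR_bernoulli] over the entries of D 1_S with N = n + 1 and write g for the Gram sum over
    S: |S| + N g <= m^p |S| + N |S|. Taking n + 1 rather than n keeps N positive, so that g can be
    isolated. *)
Lemma Theta_le_opnorm (p m : R) (n : nat) : 1 < p -> p <= n.+2%:R -> 0 <= m ->
  (lp_opnorm p (opact D) <= m%:E)%E ->
  (Theta Gram <= (1 - (1 - m `^ p) / n.+1%:R)%:E)%E.
Proof.
move=> p1 pn m0 Dm; apply: Theta_le => S.
have [->|S0] := eqVneq S fset0; first by rewrite !big_seq_fset0 cardfs0 mulr0.
have P := esum_indic_le p m S p1 m0 Dm S0.
pose u i := \sum_(j <- S) D i j.
have u01 i : 0 <= u i <= 1 by rewrite row_le1 sumr_ge0.
have N0 : 0 < n.+1%:R :> R by rewrite ltr0n.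
have nn0 : 0 <= n.+1%:R :> R by exact: ltW.
(* Both sides are kept free of subtraction, so that the unordered sums split over nonnegative
   terms. *)
have : (\esum_(i in [set: I]) ((u i)%:E + n.+1%:R%:E * (u i ^+ 2)%:E) <=
  \esum_(i in [set: I]) ((u i `^ p)%:E + n.+1%:R%:E * (u i)%:E))%E.
  apply: le_esum => i _; rewrite -!EFinM -!EFinD lee_fin powR_bernoulli//.
  by rewrite pn andbT; lra.
have u2E (i : I) : (0 <= (u i ^+ 2)%:E)%E by rewrite lee_fin sqr_ge0.
rewrite !esumD; last 4 first.
- by move=> i _; rewrite lee_fin powR_ge0.
- by move=> i _; rewrite -EFinM lee_fin mulr_ge0//; case/andP: (u01 i).
- by move=> i _; rewrite lee_fin; case/andP: (u01 i).
- by move=> i _; rewrite -EFinM lee_fin mulr_ge0// sqr_ge0.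
rewrite !ge0_esumZl//; last by move=> i; rewrite lee_fin; case/andP: (u01 i).
rewrite esum_sum_col -sum_gram_EFin => /le_trans/(_ (leeD P (lexx _))).
rewrite -EFinM -!EFinD lee_fin => h.
rewrite -subr_ge0 (_ : _ - _ = (m `^ p * #|` S|%:R + n.+1%:R * #|` S|%:R -
  (#|` S|%:R + n.+1%:R * \sum_(j <- S) \sum_(k <- S) Gram j k)) / n.+1%:R).
  by rewrite divr_ge0// subr_ge0.
by field; rewrite gt_eqF.
Qed.

End doubly_stochastic_operator.

(** * The equivalence, from the two quantitative bounds *)

Lemma lt1_real_bound (R : realType) (a : \bar R) : (a < 1)%E ->
  exists2 m : R, 0 <= m < 1 & (a <= m%:E)%E.
Proof.
case: a => [r|//|_]; last by exists 0; rewrite ?lexx ?ltr01 ?leNye.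
rewrite lte_fin => r1; exists (Num.max r 0).
  by rewrite le_max lexx orbT gt_max r1 ltr01.
by rewrite lee_fin le_max lexx.
Qed.

Theorem theorem1 (R : realType) (I : choiceType) (I_neq0 : [set: I] !=set0)
    (p : R) (p_gt1 : 1 < p) (D : I -> I -> R) (D_ds : doubly_stochastic D) :
  lp_opnorm p (opact D) = 1%E <-> Theta (opmul (adjoint D) D) = 1%E.
Proof.
have p0 : 0 < p by lra.
(* At th = 1 the gap closes, so [lp_opnorm_le] also supplies the general bound 1 on the norm. *)
have contraction1 : contraction 1 p `^ p^-1 = 1.
  rewrite /contraction (_ : cheeger 1 = 1) ?subrr ?mulr0 ?subr0 ?powR1//.
  by rewrite /cheeger; field.
have gram1 (S : {fset I}) : \sum_(j <- S) \sum_(k <- S)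
    opmul (adjoint D) D j k <= 1 * #|` S|%:R.
  by rewrite mul1r sum_gram_le_card.
have Theta1 : (Theta (opmul (adjoint D) D) <= 1)%E by exact: Theta_le.
have norm1 : (lp_opnorm p (opact D) <= 1)%E.
  by rewrite -[1%E]/(1%R%:E) -contraction1 lp_opnorm_le// ler01 lexx.
(* Both quantities are at most 1, so each direction amounts to showing that one being below 1 forces
   the other below 1. *)
split=> [D1|T1]; apply/eqP; rewrite eq_le ?Theta1 ?norm1/= leNgt; apply/negP.
  move=> /lt1_real_bound[th /andP[th0 th1] Tth].
  have th01 : 0 <= th <= 1 by rewrite th0 ltW.
  have c0 : 0 <= contraction th p by exact: contraction_ge0.
  have c1 : contraction th p < 1.
    rewrite gtrBl mulr_gt0//; first by rewrite /kappa lt_min; lra.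
    by rewrite subr_gt0 cheeger_lt1// th0.
  have := @lp_opnorm_le R I D D_ds p th p_gt1 th01
    (fun S => sum_gram_le_Theta R I D th S Tth).
  rewrite D1 lee_fin leNgt => /negP; apply.
  by rewrite powR_lt1 ?c0 ?invr_gt0.
move=> /lt1_real_bound[m /andP[m0 m1] Dm].
have [n pn] : exists n : nat, p <= n.+2%:R.
  by exists (Num.truncn p); rewrite ltW// (lt_trans (truncnS_gt _))// ltr_nat.
have := @Theta_le_opnorm R I D D_ds p m n p_gt1 pn m0 Dm.
rewrite T1 lee_fin leNgt => /negP; apply.
rewrite gtrBl divr_gt0 ?ltr0n// subr_gt0.
by rewrite powR_lt1 ?m0.
Qed.
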